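(* Let $m\neq 0$, $a_1$, $a_2$ be real numbers, and let $x_1\neq x_2$ be real numbers. For every integer $n\ge 0$, the noncentral Tanny-Dowling polynomials satisfy $$\sum_{k=0}^{n}\binom{n}{k}\widetilde{\mathcal F}_{m,a_1}(k;x_1)\,\widetilde{\mathcal F}_{m,a_2}(n-k;x_2)=\frac{x_2\,\widetilde{\mathcal F}_{m,a_1+a_2}(n;x_2)-x_1\,\widetilde{\mathcal F}_{m,a_1+a_2}(n;x_1)}{x_2-x_1}.$$
   Context: For real $m\ne0$ and real $a$, the noncentral Whitney numbers of the second kind $\widetilde W_{m,a}(n,k)$ ($0\le k\le n$) are given by $\sum_{n\ge k}\widetilde W_{m,a}(n,k)\frac{z^n}{n!}=\frac{e^{-az}}{k!}\left(\frac{e^{mz}-1}{m}\right)^k$. The noncentral Tanny-Dowling polynomials are $\widetilde{\mathcal F}_{m,a}(n;x)=\sum_{k=0}^n k!\,\widetilde W_{m,a}(n,k)x^k$; equivalently, as formal power series in $z$, $\sum_{n\ge0}\widetilde{\mathcal F}_{m,a}(n;x)\frac{z^n}{n!}=\frac{me^{-az}}{m-x(e^{mz}-1)}$. Convention: $0^0=1$. *)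

(* Defs.v *)
From mathcomp Require Import all_boot all_order all_algebra.
From mathcomp Require Import reals.
Set Implicit Arguments.
Unset Strict Implicit.
Unset Printing Implicit Defensive.
Import GRing.Theory.
Local Open Scope ring_scope.

(* A formal power series \sum_n f_n z^n is its coefficient sequence f. *)
Definition fps (R : realType) := nat -> R.

Definition fps_one (R : realType) : fps R := fun n => (n == 0%N)%:R.

Definition fps_mul (R : realType) (f g : fps R) : fps R :=
  fun n => \sum_(i < n.+1) f i * g (n - i)%N.

Definition fps_pow (R : realType) (f : fps R) (k : nat) : fps R :=
  iter k (fps_mul f) (fps_one R).

(* The series e^{cz}. *)
Definition fps_exp (R : realType) (c : R) : fps R :=
  fun n => c ^+ n / n`!%:R.

(* e^{-az} / k! * ((e^{mz} - 1) / m)^k *)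
Definition whitney2_egf (R : realType) (m a : R) (k : nat) : fps R :=
  fun n => k`!%:R^-1 *
    fps_mul (fps_exp (- a))
      (fps_pow (fun j => (fps_exp m j - fps_one R j) / m) k) n.

(* Noncentral Whitney numbers of the second kind, defined by
   \sum_{n >= k} whitney2 m a n k * z^n / n! = whitney2_egf m a k;
   that the coefficients with n < k vanish is whitney2_small. *)
Definition whitney2 (R : realType) (m a : R) (n k : nat) : R :=
  n`!%:R * whitney2_egf m a k n.

Definition tanny_dowling (R : realType) (m a : R) (n : nat) : {poly R} :=
  \poly_(k < n.+1) (k`!%:R * whitney2 m a n k).

Lemma whitney2_small (R : realType) (m a : R) (n k : nat) :
  (n < k)%N -> whitney2 m a n k = 0.
Proof.
move=> lt_nk; rewrite /whitney2 /whitney2_egf.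
set u : fps R := fun j => _.
have u0 : u 0%N = 0 by rewrite /u /fps_exp /fps_one expr0 fact0 divr1 subrr mul0r.
have pow0 l : forall j, (j < l)%N -> fps_pow u l j = 0.
  elim: l => [//|l IHl] j lt_jl; rewrite /fps_pow /= /fps_mul big_ord_recl u0 mul0r add0r.
  rewrite big1 // => i _; rewrite [iter _ _ _ _]IHl ?mulr0 //.
  by rewrite lift0; case: j lt_jl i => [|j] lt_jl [i lt_ij] //=; rewrite subSS (leq_ltn_trans (leq_subr _ _)).
rewrite /fps_mul big1 ?mulr0 // => i _.
by rewrite pow0 ?mulr0 // (leq_ltn_trans (leq_subr _ _)).
Qed.

(* Main.v *)
Require Import Defs.
From mathcomp Require Import all_boot all_order all_algebra.
From mathcomp Require Import reals.
From mathcomp Require Import ring.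
Set Implicit Arguments.
Unset Strict Implicit.
Import GRing.Theory.
Local Open Scope ring_scope.

(** Put [u(z) = (e^{mz} - 1) / m] and [G_x = 1 / (1 - x u)].  The exponential
    generating function of the noncentral Tanny-Dowling polynomials at [x] is
    [e^{-az} G_x], so the binomial convolution on the left is [n!] times the
    coefficient of [z^n] in [e^{-(a1 + a2)z} G_{x1} G_{x2}].  Since
    [x2 - x1 = x2 (1 - x1 u) - x1 (1 - x2 u)], multiplication by
    [G_{x1} G_{x2}] gives the partial fraction identity
    [(x2 - x1) G_{x1} G_{x2} = x2 G_{x2} - x1 G_{x1}], and the theorem follows
    by comparing coefficients.

    Only coefficients up to [z^n] matter, so the power series are replaced by
    polynomials with the same low coefficients ([approx]), which gives access to
    commutative ring reasoning.  The series [G_x] becomes a finite geometric sum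
    ([geom]); the partial fraction identity then holds up to a multiple of
    ['X^(n.+1)] ([geom_partial_fraction]) because [u] has no constant term.  The
    link with the polynomials of the theorem is [tanny_dowling_egf]. *)

Definition approx (R : realType) (N : nat) (p : {poly R}) (f : fps R) :=
  forall i, (i <= N)%N -> p`_i = f i.

Definition whitney_base (R : realType) (m : R) : fps R :=
  fun j => (fps_exp m j - fps_one R j) / m.

(** The truncated expansion of [1 / (1 - x p)]. *)
Definition geom (R : realType) (N : nat) (p : {poly R}) (x : R) : {poly R} :=
  \sum_(k < N.+1) (x *: p) ^+ k.

Lemma approx_poly (R : realType) (N : nat) (f : fps R) :
  approx N (\poly_(i < N.+1) f i) f.
Proof. by move=> i le_iN; rewrite coef_poly ltnS le_iN. Qed.

Lemma approx_mul (R : realType) (N : nat) (p q : {poly R}) (f g : fps R) :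
  approx N p f -> approx N q g -> approx N (p * q) (fps_mul f g).
Proof.
move=> pf qg i le_iN; rewrite coefM; apply: eq_bigr => j _.
rewrite pf ?qg // ?(leq_trans (leq_subr _ _)) //.
by rewrite (leq_trans _ le_iN) // -ltnS.
Qed.

Lemma approx_pow (R : realType) (N : nat) (p : {poly R}) (f : fps R) (k : nat) :
  approx N p f -> approx N (p ^+ k) (fps_pow f k).
Proof.
move=> pf; elim: k => [|k IHk]; first by move=> i _; rewrite expr0 coef1.
by rewrite exprS; apply: approx_mul.
Qed.

Lemma fact_natr_neq0 (R : realType) (n : nat) : n`!%:R != 0 :> R.
Proof. by rewrite Num.Theory.pnatr_eq0 -lt0n fact_gt0. Qed.

Lemma bin_natr_fact (R : realType) (n k : nat) :
  (k <= n)%N -> 'C(n, k)%:R * k`!%:R * (n - k)`!%:R = n`!%:R :> R.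
Proof. by move=> le_kn; rewrite -!natrM -mulnA bin_fact. Qed.

(** [e^{bz} e^{cz} = e^{(b + c)z}]: the binomial theorem, divided by [n!]. *)
Lemma fps_mul_exp (R : realType) (b c : R) (n : nat) :
  fps_mul (fps_exp b) (fps_exp c) n = fps_exp (b + c) n.
Proof.
rewrite /fps_exp addrC exprDn mulr_suml; apply: eq_bigr => i _.
have le_in : (i <= n)%N by rewrite -ltnS.
rewrite -(bin_natr_fact R le_in) -mulr_natl.
have := fact_natr_neq0 R i; have := fact_natr_neq0 R (n - i).
have : 'C(n, i)%:R != 0 :> R by rewrite Num.Theory.pnatr_eq0 -lt0n bin_gt0.
by move=> ? ? ?; field; apply/and3P.
Qed.

Lemma whitney_base0 (R : realType) (m : R) : whitney_base m 0%N = 0.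
Proof.
by rewrite /whitney_base /fps_exp /fps_one expr0 fact0 divr1 subrr mul0r.
Qed.

Lemma scale_whitney2 (R : realType) (m a : R) (n k : nat) :
  k`!%:R * whitney2 m a n k =
  n`!%:R * fps_mul (fps_exp (- a)) (fps_pow (whitney_base m) k) n.
Proof.
by rewrite /whitney2 /whitney2_egf mulrCA mulVKf // fact_natr_neq0.
Qed.

(** The sum defining the polynomial of index [i] stops at [k = i], the geometric
    sum at [k = N]; the additional terms vanish because [u^k] is divisible by
    [z^k].  Keeping [q] arbitrary allows a product of two truncated exponentials
    to represent [e^{-(a1 + a2)z}]. *)
Lemma tanny_dowling_egf (R : realType) (N : nat) (m a x : R) (p q : {poly R})
    (i : nat) :
  approx N q (fps_exp (- a)) -> approx N p (whitney_base m) -> (i <= N)%N ->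
  (tanny_dowling m a i).[x] = i`!%:R * (q * geom N p x)`_i.
Proof.
move=> qE pu le_iN; rewrite horner_poly.
transitivity (\sum_(k < N.+1) k`!%:R * whitney2 m a i k * x ^+ k).
  rewrite (big_ord_widen N.+1 (fun k => k`!%:R * whitney2 m a i k * x ^+ k)) //.
  rewrite big_mkcond; apply: eq_bigr => k _; case: ifPn => //.
  by rewrite ltnS -ltnNge => lt_ik; rewrite whitney2_small // mulr0 mul0r.
rewrite /geom mulr_sumr coef_sum mulr_sumr; apply: eq_bigr => k _.
rewrite scale_whitney2 exprZn -scalerAr coefZ.
by rewrite (approx_mul qE (approx_pow k pu)) // -mulrA [_ * x ^+ k]mulrC.
Qed.

(** [(1 - x p) geom = 1 - (x p)^{N+1}], and [p] is divisible by ['X]. *)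
Lemma geom_inverse (R : realType) (N : nat) (p : {poly R}) (x : R) :
  p`_0 = 0 -> exists r, (1 - x *: p) * geom N p x = 1 - 'X^(N.+1) * r.
Proof.
move=> p0; have /factor_theorem[s ps] : root p 0 by rewrite rootE horner_coef0 p0.
exists ((x *: s) ^+ N.+1).
rewrite -exprMn_comm; last exact: mulrC.
by rewrite -[LHS]opprK -mulNr opprB -subrX1 opprB ps subr0 -scalerAr [s * _]mulrC.
Qed.

(** [x2 - x1 = x2 (1 - x1 p) - x1 (1 - x2 p)], times both geometric sums. *)
Lemma geom_partial_fraction (R : realType) (N : nat) (p : {poly R}) (x1 x2 : R) :
  p`_0 = 0 ->
  exists r, (x2 - x1)%:P * (geom N p x1 * geom N p x2) =
            x2%:P * geom N p x2 - x1%:P * geom N p x1 + 'X^(N.+1) * r.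
Proof.
move=> p0; have [r1] := geom_inverse N x1 p0.
have [r2] := geom_inverse N x2 p0.
rewrite -!mul_polyC; set G1 := geom N p x1; set G2 := geom N p x2 => e2 e1.
exists (x1%:P * G1 * r2 - x2%:P * G2 * r1).
transitivity (x2%:P * G2 * ((1 - x1%:P * p) * G1)
              - x1%:P * G1 * ((1 - x2%:P * p) * G2)).
  by rewrite polyCB; ring.
by rewrite e1 e2; ring.
Qed.

Unset Implicit Arguments.

Theorem theorem4 (R : realType) (m a1 a2 x1 x2 : R) (n : nat) :
  m != 0 -> x1 != x2 ->
  \sum_(k < n.+1) 'C(n, k)%:R * (tanny_dowling m a1 k).[x1]
                              * (tanny_dowling m a2 (n - k)%N).[x2]
  = (x2 * (tanny_dowling m (a1 + a2) n).[x2]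
     - x1 * (tanny_dowling m (a1 + a2) n).[x1]) / (x2 - x1).
Proof.
move=> _ neq_x.
have nz_x : x2 - x1 != 0 by rewrite subr_eq0 eq_sym.
pose p := \poly_(i < n.+1) whitney_base m i.
pose q (a : R) := \poly_(i < n.+1) fps_exp (- a) i.
have pu : approx n p (whitney_base m) by exact: approx_poly.
have qE a : approx n (q a) (fps_exp (- a)) by exact: approx_poly.
have qqE : approx n (q a1 * q a2) (fps_exp (- (a1 + a2))).
  by move=> i le_in; rewrite (approx_mul (qE a1) (qE a2)) // fps_mul_exp opprD.
have p0 : p`_0 = 0 by rewrite pu // whitney_base0.
apply: (canRL (mulfK nz_x)).
rewrite !(tanny_dowling_egf _ qqE pu) //.
have -> : \sum_(k < n.+1) 'C(n, k)%:R * (tanny_dowling m a1 k).[x1]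
                              * (tanny_dowling m a2 (n - k)%N).[x2]
          = n`!%:R * ((q a1 * geom n p x1) * (q a2 * geom n p x2))`_n.
  rewrite coefM mulr_sumr; apply: eq_bigr => k _.
  have le_kn : (k <= n)%N by rewrite -ltnS.
  rewrite (tanny_dowling_egf _ (qE a1) pu) //.
  rewrite (tanny_dowling_egf _ (qE a2) pu) ?leq_subr //.
  by rewrite -(bin_natr_fact R le_kn); ring.
have [r pf] := geom_partial_fraction n x1 x2 p0.
have key : (x2 - x1)%:P * ((q a1 * geom n p x1) * (q a2 * geom n p x2)) =
    x2%:P * (q a1 * q a2 * geom n p x2) - x1%:P * (q a1 * q a2 * geom n p x1)
    + 'X^(n.+1) * (q a1 * q a2 * r).
  transitivity (q a1 * q a2 * ((x2 - x1)%:P * (geom n p x1 * geom n p x2))).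
    by ring.
  by rewrite pf; ring.
have /(congr1 (fun s : {poly R} => s`_n)) := key.
rewrite coefD coefB !coefCM coefXnM ltnSn addr0 => coef_key.
by rewrite mulrAC -mulrA coef_key; ring.
Qed.
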